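(* Let $(X,d_X)$ be a metric space and $(Y,\|\cdot\|)$ a Banach space. Assume that for some $\lambda\ge 1$: (i) $X$ is locally $\lambda$-Lipschitz representable into every finite-codimensional subspace of $Y$; that is, for every finite-codimensional subspace $Z$ of $Y$ and every metric ball $B$ in $X$ there are a map $f_{B,Z}\colon B\to Z$ and a scaling factor $s>0$ such that $s\,d_X(x,y)\le\|f_{B,Z}(x)-f_{B,Z}(y)\|\le\lambda s\,d_X(x,y)$ for all $x,y\in B$; (ii) for every ball $B$ in $X$, its image $f_{B,Z}(B)$ under any of the local embeddings $f_{B,Z}$ from (i) spans a finite-dimensional subspace. Then $X$ admits a bi-Lipschitz embedding into $Y$.
   Context: A bi-Lipschitz embedding of $(X,d_X)$ into a Banach space $Y$ is a map $f\colon X\to Y$ for which there exist constants $s>0$ and $D\in[1,\infty)$ with $s\,d_X(x,y)\le \|f(x)-f(y)\|\le D s\,d_X(x,y)$ for all $x,y\in X$. The scaling factor $s$ in (i) may depend on $B$ and $Z$, whereas $\lambda$ does not. *)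

(* Defs.v *)
From HB Require Import structures.
From mathcomp Require Import all_boot all_order all_algebra.
From mathcomp Require Import all_classical all_reals all_analysis.
Import Order.TTheory GRing.Theory Num.Theory.
Import numFieldNormedType.Exports.

Set Implicit Arguments.
Unset Strict Implicit.
Unset Printing Implicit Defensive.

Local Open Scope classical_set_scope.
Local Open Scope ring_scope.

Section LinearSubspaces.
Variables (R : realType) (V : lmodType R).
Implicit Types (A S Z F : set V).

Definition linear_subspace S : Prop := submod_closed [in S].

Definition linear_span A : set V := smallest linear_subspace A.

Definition finite_dimensional S : Prop :=
  exists2 F, finite_set F & S = linear_span F.

(* The quotient [V / Z] is finite-dimensional iff finitely many vectors
   together with [Z] span [V]. *)
Definition finite_codimensional Z : Prop :=
  linear_subspace Z /\
  exists2 F, finite_set F & linear_span (Z `|` F) = [set: V].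

End LinearSubspaces.

(* Subspaces of a Banach space are taken to be closed, as is customary;
   for finite-codimensional subspaces this is not automatic. *)
Definition closed_finite_codimensional (R : realType)
    (Y : completeNormedModType R) (Z : set Y) : Prop :=
  closed Z /\ finite_codimensional Z.

Section BiLipschitz.
Variables (R : realType) (X : metricType R) (Y : completeNormedModType R).
Implicit Types (B : set X) (Z : set Y) (f : X -> Y).

Definition metric_ball B : Prop :=
  exists x r, 0 < r /\ B = ball x r.

Definition bilipschitz_estimate (s D : R) B f : Prop :=
  forall x y, B x -> B y ->
    s * mdist x y <= `|f x - f y| <= D * s * mdist x y.

(* Maps [B -> Z] are represented by total maps [X -> Y], whose values outside
   [B] are irrelevant. *)
Definition local_embedding (lambda : R) B Z f : Prop :=
  (forall x, B x -> Z (f x)) /\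
  exists2 s : R, 0 < s & bilipschitz_estimate s lambda B f.

Definition bilipschitz_embedding f : Prop :=
  exists s D : R, [/\ 0 < s, 1 <= D & bilipschitz_estimate s D [set: X] f].

End BiLipschitz.

(* Main.v *)
Require Import Defs.
From HB Require Import structures.
From mathcomp Require Import all_boot all_order all_algebra.
From mathcomp Require Import all_classical all_reals all_analysis.
From mathcomp Require Import zify lra ring.
Import Order.TTheory GRing.Theory Num.Theory.
Import numFieldNormedType.Exports.

Set Implicit Arguments.
Unset Strict Implicit.
Unset Printing Implicit Defensive.

Local Open Scope classical_set_scope.
Local Open Scope ring_scope.

(** The target space is split into an almost direct sum of a line and of
    finite-dimensional pieces that carry local embeddings of larger and larger
    balls, and these local embeddings are glued along a family of tents.

    Fix a base point [x0], write [rho x] for the distance from [x0] to [x], and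
    let [B n] be the ball of radius [3 * 2 ^+ n] about [x0].  Subspaces [Z n]
    are chosen recursively: [Z n] lies in [Z n.-1] and satisfies
    [|u| <= 2 |u + z|] for all [z] in [Z n] and all [u] in the span of a unit
    vector [e] and of the images of [B i] under the local embeddings into [Z i],
    for [i < n] ([separated_sequence]).  This span is finite-dimensional, and
    such a [Z n] exists because its unit ball has a finite net, the points [p]
    of which can be made to satisfy [|p| <= |p + z|] by intersecting finitely
    many kernels of norming functionals ([finite_dimensional_separation]).  The
    norming functionals come from the Hahn-Banach theorem, proved here through
    the fact that a minimal sublinear functional is linear
    ([norming_functional]).  Consequently, if [v i] lies in the span of the
    image of [B i] inside [Z i], then the projections of [a *: e + \sum_i v i]
    onto its partial sums have norm at most [2], uniformly in the dimensions
    ([separated_partial_sum]).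

    Let [F n] be the local embedding of [B n], rescaled so that
    [d <= |F n x - F n y| <= lambda d] and [F n x0 = 0], and put
    [g x = rho x *: e + \sum_n tent n (1 + rho x) *: F n x].  Every summand is
    [4 * lambda]-Lipschitz, since [|F n|] is of order [2 ^+ n] on [B n] whereas
    the slope of the [n]-th tent is [2 ^- n] ([piece_lipschitz]); at most three
    summands are nonzero at a given point, so [g] is Lipschitz.  Conversely, let
    [rho y <= rho x] and choose [n] such that the [n]-th tent is at least [1/2]
    at [x].  The [n]-th component of [g x - g y] has norm at least
    [d / 2 - 3 * lambda * |rho x - rho y|] ([piece_lower_bound]), and its
    component along [e] has norm [|rho x - rho y|].  Both components are
    controlled by [|g x - g y|], so [d <= (8 + 12 * lambda) |g x - g y|]. *)

(** * Norming functionals *)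

(** A sublinear functional; the inequality in the homogeneity clause implies
    equality, on replacing [c] by its inverse. *)
Definition sublinear (R : realType) (V : lmodType R) (q : V -> R) : Prop :=
  (forall x y, q (x + y) <= q x + q y) /\
  (forall c x, 0 < c -> q (c *: x) <= c * q x).

Lemma sublinearZ (R : realType) (V : lmodType R) (q : V -> R) c x :
  sublinear q -> 0 < c -> q (c *: x) = c * q x.
Proof.
move=> [_ qZ] c0; apply/eqP; rewrite eq_le qZ//=.
have ci0 : 0 < c^-1 by rewrite invr_gt0.
have := qZ c^-1 (c *: x) ci0.
by rewrite scalerA mulVf ?gt_eqF// scale1r -ler_pdivrMl ?invr_gt0// invrK.
Qed.

Lemma sublinear0 (R : realType) (V : lmodType R) (q : V -> R) :
  sublinear q -> q 0 = 0.
Proof.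
move=> sq; have := @sublinearZ _ _ q 2 0 sq ltac:(by []).
by rewrite scaler0; lra.
Qed.

Lemma sublinear_lb (R : realType) (V : lmodType R) (q : V -> R) x :
  sublinear q -> - q (- x) <= q x.
Proof.
move=> sq; have := sq.1 x (- x); rewrite subrr sublinear0//; lra.
Qed.

(** The largest sublinear functional [p] below [q] with [p (- v) = - q v];
    for a minimal [q] it coincides with [q], which makes [q] odd. *)
Definition sublinear_shift (R : realType) (V : lmodType R) (q : V -> R) (v x : V)
    : R :=
  inf [set r | exists2 t, 0 <= t & r = q (x + t *: v) - t * q v].

Lemma sublinear_shift_le (R : realType) (V : lmodType R) (q : V -> R) v x t :
  sublinear q -> 0 <= t -> sublinear_shift q v x <= q (x + t *: v) - t * q v.
Proof.
move=> sq t0; apply: ge_inf; last by exists t.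
exists (- q (- x)) => _ [s s0 ->].
have -> : s * q v = q (s *: v).
  by move: s0; rewrite le_eqVlt => /predU1P[<-|s0];
    rewrite ?scale0r ?mul0r ?sublinear0 ?sublinearZ.
have := sq.1 (- x) (x + s *: v); rewrite addKr; lra.
Qed.

Lemma le_sublinear_shift (R : realType) (V : lmodType R) (q : V -> R) v x m :
  (forall t, 0 <= t -> m <= q (x + t *: v) - t * q v) ->
  m <= sublinear_shift q v x.
Proof.
move=> H; apply: lb_le_inf => [|_ [t t0 ->]]; last exact: H.
by exists (q (x + 0 *: v) - 0 * q v), 0.
Qed.

Lemma sublinear_shift_le_id (R : realType) (V : lmodType R) (q : V -> R) v x :
  sublinear q -> sublinear_shift q v x <= q x.
Proof.
move=> sq; apply: (le_trans (@sublinear_shift_le _ _ q v x 0 sq _)) => //.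
by rewrite scale0r addr0 mul0r subr0.
Qed.

Lemma sublinear_shift_opp (R : realType) (V : lmodType R) (q : V -> R) v :
  sublinear q -> sublinear_shift q v (- v) <= - q v.
Proof.
move=> sq; apply: (le_trans (@sublinear_shift_le _ _ q v (- v) 1 sq _)) => //.
by rewrite scale1r addNr sublinear0// mul1r sub0r.
Qed.

Lemma sublinear_shiftP (R : realType) (V : lmodType R) (q : V -> R) v :
  sublinear q -> sublinear (sublinear_shift q v).
Proof.
move=> sq; split => [x y|c x c0].
  rewrite -lerBlDl; apply: le_sublinear_shift => t t0.
  rewrite lerBlDr -lerBlDl; apply: le_sublinear_shift => s s0.
  have := @sublinear_shift_le _ _ q v (x + y) (s + t) sq (addr_ge0 s0 t0).
  have := sq.1 (x + s *: v) (y + t *: v).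
  by rewrite addrACA -scalerDl mulrDl; lra.
rewrite -ler_pdivrMl//; apply: le_sublinear_shift => t t0.
rewrite ler_pdivrMl//.
have := @sublinear_shift_le _ _ q v (c *: x) (c * t) sq (mulr_ge0 (ltW c0) t0).
by rewrite -scalerA -scalerDr (sublinearZ (q := q))// mulrBr mulrA.
Qed.

(** The infimum of a chain of sublinear functionals is sublinear, so minimal
    ones exist below any given one. *)
Lemma minimal_sublinear (R : realType) (V : lmodType R) (N : V -> R) :
  sublinear N ->
  exists q : V -> R, [/\ sublinear q, (forall x, q x <= N x) &
    forall p, sublinear p -> (forall x, p x <= q x) -> p = q].
Proof.
move=> sN.
pose T := {q : V -> R | sublinear q /\ forall x, q x <= N x}.
pose rel (s t : T) : bool := `[< forall x, sval t x <= sval s x >].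
have [] := @Zorn T rel.
- by move=> t; apply/asboolP.
- move=> r s t /asboolP rs /asboolP st; apply/asboolP => x.
  exact: le_trans (st x) (rs x).
- move=> [s Hs] [t Ht] /asboolP /= st /asboolP /= ts.
  have E : s = t by apply/funext => x; apply/le_anti; rewrite st ts.
  by subst t; congr exist; exact: Prop_irrelevance.
- move=> A totA.
  (* The infimum of a nonempty chain is bounded below by [- N (- x)] at [x]. *)
  have [A0|/set0P[a0 Aa0]] := eqVneq A set0.
    by exists (exist _ N (conj sN (fun=> lexx _))) => s; rewrite A0.
  pose q x := inf [set r | exists2 s, A s & r = sval s x].
  have q_le s x : A s -> q x <= sval s x.
    move=> As; apply: ge_inf; last by exists s.
    exists (- N (- x)) => _ [t _ ->]; have [/= st tN] := svalP t.
    by have := tN (- x); have := sublinear_lb x st; lra.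
  have le_q m x : (forall s, A s -> m <= sval s x) -> m <= q x.
    move=> H; apply: lb_le_inf => [|_ [s As ->]]; last exact: H.
    by exists (sval a0 x), a0.
  have sq : sublinear q.
    split => [x y|c x c0].
      rewrite -lerBlDl; apply: (le_q) => t At; rewrite lerBlDr -lerBlDl.
      apply: (le_q) => s As; rewrite lerBlDl.
      have [/asboolP H|/asboolP H] := totA s t As At.
        have := q_le t (x + y) At; have := (svalP t).1.1 x y.
        by have := H x; lra.
      have := q_le s (x + y) As; have := (svalP s).1.1 x y.
      by have := H y; lra.
    rewrite -ler_pdivrMl//; apply: (le_q) => s As; rewrite ler_pdivrMl//.
    by rewrite -(sublinearZ _ (svalP s).1 c0); exact: q_le.
  have qN x : q x <= N x by exact: le_trans (q_le a0 x Aa0) ((svalP a0).2 x).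
  exists (exist _ q (conj sq qN)) => s As; apply/asboolP => x /=.
  exact: q_le.
- move=> [q [sq qN]] minq; exists q; split => // p sp pq.
  have pN x : p x <= N x by exact: le_trans (pq x) (qN x).
  have := minq (exist _ p (conj sp pN)).
  by move=> /(_ (asboolT pq)) /(congr1 (@sval _ _)).
Qed.

(** Minimality gives [q = sublinear_shift q v] for all [v], hence oddness. *)
Lemma minimal_sublinear_scalar (R : realType) (V : lmodType R) (q : V -> R) :
  sublinear q -> (forall p, sublinear p -> (forall x, p x <= q x) -> p = q) ->
  scalar q.
Proof.
move=> sq minq.
have qN v : q (- v) = - q v.
  have E : sublinear_shift q v = q.
    apply: minq; first exact: sublinear_shiftP.
    by move=> x; exact: sublinear_shift_le_id.
  apply/le_anti/andP; split; first by rewrite -{1}E sublinear_shift_opp.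
  have := sublinear_lb v sq; lra.
have qD x y : q (x + y) = q x + q y.
  apply/le_anti/andP; split; first exact: sq.1.
  have := sq.1 (x + y) (- y); rewrite addrK qN; lra.
move=> a u v; rewrite qD; congr (_ + _).
have [a0|a0|->] := ltgtP a 0.
- by rewrite -[a]opprK scaleNr qN sublinearZ ?oppr_gt0// !mulNr.
- exact: sublinearZ.
- by rewrite scale0r mul0r sublinear0.
Qed.

(** The Hahn-Banach theorem in the form of supporting functionals. *)
Lemma norming_functional (R : realType) (V : normedModType R) (p : V) :
  exists phi : V -> R,
    [/\ scalar phi, (forall y, `|phi y| <= `|y|) & phi p = `|p|].
Proof.
have sN : sublinear (fun x : V => `|x|).
  split => [x y|c x c0]; first exact: ler_normD.
  by rewrite normrZ gtr0_norm.
have [q [sq qle qmin]] := minimal_sublinear (sublinear_shiftP p sN).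
have qlin := minimal_sublinear_scalar sq qmin.
have qN v : q (- v) = - q v.
  by have := qlin (-1) v 0; rewrite scaleN1r addr0 sublinear0// mulN1r addr0.
have qnorm x : q x <= `|x|.
  exact: le_trans (qle x) (sublinear_shift_le_id _ _ sN).
exists q; split => // [y|].
  by rewrite ler_norml qnorm andbT lerNl -qN -normrN qnorm.
apply/le_anti; rewrite qnorm/= -lerN2 -qN.
exact: le_trans (qle _) (sublinear_shift_opp _ sN).
Qed.

(** * Linear spans and closed subspaces of finite codimension *)

Lemma linear_subspaceP (R : realType) (V : lmodType R) (S : set V) :
  linear_subspace S <->
  S 0 /\ forall a u v, S u -> S v -> S (a *: u + v).
Proof.
split=> [[S0 SD]|[S0 SD]]; split.
- by move: S0; rewrite inE.
- move=> a u v Su Sv; have := SD a u v; rewrite !inE; exact.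
- by rewrite inE.
- move=> a u v; rewrite !inE; exact: SD.
Qed.

Lemma linear_subspaceD (R : realType) (V : lmodType R) (S : set V) u v :
  linear_subspace S -> S u -> S v -> S (u + v).
Proof. by move=> /linear_subspaceP[_ H] Su Sv; rewrite -[u]scale1r; exact: H. Qed.

Lemma linear_subspaceZ (R : realType) (V : lmodType R) (S : set V) a u :
  linear_subspace S -> S u -> S (a *: u).
Proof. by move=> /linear_subspaceP[S0 H] Su; rewrite -[a *: u]addr0; exact: H. Qed.

Lemma linear_subspaceB (R : realType) (V : lmodType R) (S : set V) u v :
  linear_subspace S -> S u -> S v -> S (u - v).
Proof.
move=> HS Su Sv; apply: linear_subspaceD => //.
by rewrite -scaleN1r; exact: linear_subspaceZ.
Qed.

Lemma linear_subspace_sum (R : realType) (V : lmodType R) (S : set V)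
    (I : eqType) (r : seq I) (F : I -> V) :
  linear_subspace S -> (forall i, i \in r -> S (F i)) -> S (\sum_(i <- r) F i).
Proof.
move=> HS H; rewrite big_seq; apply: (big_ind S) => //.
- by have /linear_subspaceP[] := HS.
- by move=> u v; exact: linear_subspaceD.
Qed.

Lemma linear_span_subspace (R : realType) (V : lmodType R) (A : set V) :
  linear_subspace (linear_span A).
Proof.
apply/linear_subspaceP; split => [S [HS _]|a u v Su Sv S [HS AS]].
  by have /linear_subspaceP[] := HS.
have /linear_subspaceP[_ H] := HS.
by apply: H; [exact: Su|exact: Sv].
Qed.

Lemma sub_linear_span (R : realType) (V : lmodType R) (A : set V) :
  A `<=` linear_span A.
Proof. exact: sub_gen_smallest. Qed.

Lemma linear_span_sub (R : realType) (V : lmodType R) (A S : set V) :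
  linear_subspace S -> A `<=` S -> linear_span A `<=` S.
Proof. exact: smallest_sub. Qed.

Lemma linear_span_mono (R : realType) (V : lmodType R) (A B : set V) :
  A `<=` B -> linear_span A `<=` linear_span B.
Proof.
move=> AB; apply: linear_span_sub; first exact: linear_span_subspace.
exact: subset_trans AB (@sub_linear_span _ _ _).
Qed.

Lemma closed_finite_codimensionalT (R : realType) (Y : completeNormedModType R) :
  closed_finite_codimensional [set: Y].
Proof.
split; first exact: closedT.
split; first by apply/linear_subspaceP.
exists set0; first exact: finite_set0.
rewrite setU0; apply/seteqP; split => // x _; exact: sub_linear_span.
Qed.

Lemma bounded_scalar_continuous (R : realType) (Y : completeNormedModType R)
    (phi : Y -> R) :
  scalar phi -> (forall y, `|phi y| <= `|y|) -> continuous phi.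
Proof.
move=> lphi bphi x; apply/cvgrPdist_lt => e e0; near=> y.
have -> : phi x - phi y = phi (x - y).
  by rewrite [in RHS]addrC -[- y]scaleN1r lphi mulN1r addrC.
apply: le_lt_trans (bphi _) _; near: y.
exact: cvgr_dist_lt.
Unshelve. all: by end_near. Qed.

(** If [phi] does not vanish on [Z], then [Z] is spanned by [Z `&` ker phi]
    and one further vector. *)
Lemma closed_finite_codimensional_kernel (R : realType)
    (Y : completeNormedModType R) (Z : set Y) (phi : Y -> R) :
  closed_finite_codimensional Z ->
  scalar phi -> (forall y, `|phi y| <= `|y|) ->
  closed_finite_codimensional (Z `&` [set y | phi y = 0]).
Proof.
move=> [cZ [sZ [F fF spanF]]] lphi bphi.
have [Z0 ZD] : _ /\ _ := (linear_subspaceP _).1 sZ.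
have phi0 : phi 0 = 0 by apply/eqP; rewrite -normr_le0 -(normr0 Y).
have phiZ a u : phi (a *: u) = a * phi u by rewrite -[a *: u]addr0 lphi phi0 addr0.
split.
  apply: closedI => //; apply: (@preimage_closed _ _ phi [set 0]).
    by move=> x _; exact: bounded_scalar_continuous.
  exact: closed_eq.
have sK : linear_subspace (Z `&` [set y | phi y = 0]).
  apply/linear_subspaceP; split => // a u v [Zu /= u0] [Zv /= v0].
  by split; [exact: ZD|rewrite /= lphi u0 v0 mulr0 addr0].
split => //.
have [[z0 Zz0 pz0]|H] := pselect (exists2 z, Z z & phi z != 0); last first.
  exists F => //; rewrite (_ : _ `&` _ = Z)//; apply/seteqP.
  split => z; first by case.
  by move=> Zz; split => //=; apply: contrapT => /eqP pz; apply: H; exists z.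
exists (z0 |` F); first by rewrite finite_setU; split.
apply/seteqP; split => // y _.
set A := (X in linear_span X).
have sA := @linear_span_subspace _ _ A.
have : linear_span (Z `|` F) y by rewrite spanF.
apply: linear_span_sub => // {}y [Zy|Fy]; last first.
  by apply: sub_linear_span; right; right.
rewrite -[y](subrK ((phi y / phi z0) *: z0)); apply: (linear_subspaceD sA).
  apply: sub_linear_span; left; split.
    by apply: linear_subspaceB => //; exact: linear_subspaceZ.
  by rewrite /= addrC -scaleNr lphi mulNr divfK// addNr.
by apply: (linear_subspaceZ _ sA); apply: sub_linear_span; right; left.
Qed.

(** Finitely many prescribed vectors can be made orthogonal, in the sense of
    Birkhoff, to a closed subspace of finite codimension. *)
Lemma birkhoff_orthogonal_seq (R : realType) (Y : completeNormedModType R)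
    (Z : set Y) (s : seq Y) :
  closed_finite_codimensional Z ->
  exists Z', [/\ closed_finite_codimensional Z', Z' `<=` Z &
    forall p z, p \in s -> Z' z -> `|p| <= `|p + z|].
Proof.
move=> cZ; elim: s => [|p s [Z' [cZ' Z'Z Hs]]]; first by exists Z; split.
have [phi [lphi bphi phip]] := norming_functional p.
exists (Z' `&` [set y | phi y = 0]); split.
- exact: closed_finite_codimensional_kernel.
- by move=> z [/Z'Z].
- move=> q z; rewrite inE => /predU1P[->|qs] [Z'z /= z0]; last exact: Hs.
  rewrite -[leLHS]phip -[phi p]addr0 -z0 -[phi p]mul1r -lphi scale1r.
  exact: le_trans (ler_norm _) (bphi _).
Qed.

(** * Complementing a finite-dimensional subspace *)

Lemma interval_net (R : realType) (M e : R) :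
  0 < e -> exists s : seq R,
    forall a, `|a| <= M -> exists2 b, b \in s & `|a - b| <= e.
Proof.
move=> e0.
suff [s Hs] : exists s : seq R, forall a,
    - M <= a <= - M + (Num.bound (2 * M / e))%:R * e ->
    exists2 b, b \in s & `|a - b| <= e.
  exists s => a; rewrite ler_norml => /andP[Ma aM]; apply: Hs.
  rewrite Ma/= -lerBlDl opprK -ler_pdivrMr//.
  apply: le_trans (ltW (archi_boundP _)); last first.
    by rewrite divr_ge0 ?(ltW e0)// mulr_ge0//; lra.
  by rewrite ler_pM2r ?invr_gt0//; lra.
elim: (Num.bound _) => [|n [s Hs]].
  exists [:: - M] => a; rewrite mul0r addr0 => aM; exists (- M).
    by rewrite mem_head.
  by rewrite ler_norml; lra.
exists ((- M + n.+1%:R * e) :: s) => a /andP[Ma aM].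
have [an|an] := leP a (- M + n%:R * e).
  have [|b bs ab] := Hs a; first by rewrite Ma.
  by exists b => //; rewrite inE bs orbT.
exists (- M + n.+1%:R * e); first by rewrite mem_head.
by move: aM; rewrite -natr1 ler_norml mulrDl mul1r; lra.
Qed.

(** A bounded operator, of finite rank by construction, that fixes the span of
    [F].  The last clause is the total boundedness of the image of the unit
    ball.  A new generator [w] is handled by adding to [P u] the rank-one term
    [phi (u - P u) / |w'| *: w'], where [w' = w - P w] and [phi] norms [w']. *)
Lemma finite_rank_projection (R : realType) (Y : normedModType R) (F : set Y) :
  finite_set F ->
  exists (P : Y -> Y) (K : R),
    [/\ linear P, (forall u, `|P u| <= K * `|u|),
        (forall u, linear_span F u -> P u = u) &
        forall e, 0 < e -> exists s : seq Y, forall u, `|u| <= 1 ->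
          exists2 p, p \in s & `|P u - p| <= e].
Proof.
move=> /finite_seqP[s ->] {F}.
elim: s => [|w s [P [K [lP bP idP netP]]]].
  exists (fun=> 0), 0; split => [a u v|u|u|e e0].
  - by rewrite scaler0 addr0.
  - by rewrite normr0 mul0r.
  - move=> Hu; apply/esym/(Hu [set 0]); split; last by [].
    by apply/linear_subspaceP; split => // a x y /= -> ->; rewrite scaler0 addr0.
  - exists [:: 0] => u _; exists 0; first by rewrite mem_head.
    by rewrite subrr normr0 ltW.
have extend (P' : Y -> Y) : linear P' -> P' w = w ->
    (forall u, linear_span [set` s] u -> P' u = u) ->
    forall u, linear_span [set` w :: s] u -> P' u = u.
  move=> lP' P'w P's u; apply: (linear_span_sub (S := [set u | P' u = u])).
    apply/linear_subspaceP; split => /=.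
      by have := lP' (-1) 0 0; rewrite !scaleN1r !addNr.
    by move=> a x y /= xP yP; rewrite lP' xP yP.
  move=> x /=; rewrite inE => /predU1P[->//|xs].
  by apply: P's; exact: sub_linear_span.
have [w0|w0] := eqVneq (w - P w) 0.
  exists P, K; split => //; apply: extend => //.
  by apply/esym/eqP; rewrite -subr_eq0 w0.
set w' := w - P w in w0.
have w'0 : 0 < `|w'| by rewrite normr_gt0.
have [phi [lphi bphi phiw]] := norming_functional w'.
pose psi u := phi (u - P u) / `|w'|.
have lpsi : scalar psi.
  move=> a u v; rewrite /psi lP opprD addrACA -scalerBr lphi mulrDl.
  by rewrite mulrA.
pose M := (1 + K) / `|w'|.
have bpsi u : `|psi u| <= M * `|u|.
  rewrite /psi normrM normfV normr_id /M mulrAC ler_pM2r ?invr_gt0//.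
  apply: le_trans (bphi _) _; apply: le_trans (ler_normB _ _) _.
  by rewrite mulrDl mul1r lerD2l.
exists (fun u => P u + psi u *: w'), (K + M * `|w'|); split.
- move=> a u v; rewrite lP lpsi scalerDl -scalerA addrACA.
  by rewrite -scalerDr.
- move=> u; apply: le_trans (ler_normD _ _) _; rewrite mulrDl lerD//.
  by rewrite normrZ mulrAC ler_pM2r.
- apply: extend.
  + move=> a u v; rewrite lP lpsi scalerDl -scalerA addrACA.
    by rewrite -scalerDr.
  + by rewrite /psi -/w' phiw divff ?gt_eqF// scale1r addrC subrK.
  + move=> u us; have -> : psi u = 0; last by rewrite scale0r addr0 idP.
    have phi0 : phi 0 = 0 by apply/eqP; rewrite -normr_le0 -(normr0 Y).
    by rewrite /psi idP// subrr phi0 mul0r.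
move=> e e0.
have e20 : 0 < e / 2 by rewrite divr_gt0.
have [s1 Hs1] := netP _ e20.
have [s2 Hs2] := interval_net M (divr_gt0 e20 w'0).
exists [seq p + b *: w' | p <- s1, b <- s2] => u u1.
have [p ps1 Hp] := Hs1 u u1.
have [b bs2 Hb] : exists2 b, b \in s2 & `|psi u - b| <= e / 2 / `|w'|.
  apply: Hs2; apply: le_trans (bpsi u) _.
  have M0 : 0 <= M.
    by have := le_trans (normr_ge0 _) (bpsi w'); rewrite pmulr_lge0.
  by rewrite -[leRHS]mulr1 ler_wpM2l.
exists (p + b *: w'); first exact: allpairs_f.
rewrite opprD addrACA -scalerBl; apply: le_trans (ler_normD _ _) _.
by rewrite [leRHS](splitr e) lerD// normrZ -ler_pdivlMr.
Qed.

(** The span of [F] is separated from some smaller [Z'] with the constant [2],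
    whatever its dimension: the vectors of a net of its unit ball are made
    Birkhoff-orthogonal to [Z']. *)
Lemma finite_dimensional_separation (R : realType) (Y : completeNormedModType R)
    (Z F : set Y) :
  closed_finite_codimensional Z -> finite_set F ->
  exists Z', [/\ closed_finite_codimensional Z', Z' `<=` Z &
    forall u z, linear_span F u -> Z' z -> `|u| <= 2 * `|u + z|].
Proof.
move=> cZ fF; have [P [K [_ _ idP netP]]] := finite_rank_projection fF.
have e4 : 0 < 4^-1 :> R by rewrite invr_gt0.
have [s Hs] := netP _ e4.
have [Z' [cZ' Z'Z orth]] := birkhoff_orthogonal_seq s cZ.
exists Z'; split => // u z Fu Z'z.
have [->|u0] := eqVneq u 0; first by rewrite normr0 mulr_ge0.
have nu0 : 0 < `|u| by rewrite normr_gt0.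
set c := `|u|^-1.
have c0 : 0 < c by rewrite invr_gt0.
have cu : `|c *: u| = 1 by rewrite normrZ gtr0_norm// mulVf ?gt_eqF.
have [|p ps up] := Hs (c *: u); first by rewrite cu.
rewrite idP in up; last exact: (linear_subspaceZ _ (linear_span_subspace F)).
have Z'cz : Z' (c *: z) by apply: linear_subspaceZ => //; have [_ []] := cZ'.
have H := orth p _ ps Z'cz.
have H1 : 1 - 4^-1 <= `|p|.
  by have := ler_distD p (c *: u) 0; rewrite !subr0 cu; lra.
have H2 : `|p + c *: z| <= `|c *: (u + z)| + 4^-1.
  rewrite scalerDr; have := ler_distD (c *: u + c *: z) (p + c *: z) 0.
  rewrite !subr0 opprD addrACA subrr addr0 distrC; lra.
have H3 : 1 <= 2 * (c * `|u + z|).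
  by move: H2; rewrite normrZ gtr0_norm//; lra.
by move: H3; rewrite mulrCA ler_pdivlMl// mulr1.
Qed.

(** * Sequences of separated finite-dimensional subspaces *)

(** The subspaces [span (G n)] increase, the subspaces [Z n] decrease, each
    [span (G n)] is separated from [Z n], and [Z n] determines a
    finite-dimensional piece [span (A n (Z n))] included in [span (G n.+1)]. *)
Lemma separated_sequence (R : realType) (Y : completeNormedModType R) (e : Y)
    (A : nat -> set Y -> set Y) :
  (forall n Z, closed_finite_codimensional Z ->
    finite_dimensional (linear_span (A n Z))) ->
  exists Z G : nat -> set Y,
    [/\ forall n, closed_finite_codimensional (Z n),
        forall n, Z n.+1 `<=` Z n /\ G n `<=` G n.+1,
        forall n u z, linear_span (G n) u -> Z n z -> `|u| <= 2 * `|u + z|,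
        forall n, A n (Z n) `<=` linear_span (G n.+1) &
        linear_span (G 0) e].
Proof.
move=> finA.
have /choice[next nextP] : forall ZF : set Y * set Y, exists Z',
    closed_finite_codimensional ZF.1 -> finite_set ZF.2 ->
    [/\ closed_finite_codimensional Z', Z' `<=` ZF.1 &
     forall u z, linear_span ZF.2 u -> Z' z -> `|u| <= 2 * `|u + z|].
  move=> -[Z F] /=.
  have [[cZ fF]|H] := pselect (closed_finite_codimensional Z /\ finite_set F).
    by have [Z' HZ'] := finite_dimensional_separation cZ fF; exists Z'.
  by exists Z => cZ fF; exfalso; exact: H.
have /choice[gen genP] : forall nZ : nat * set Y, exists F,
    closed_finite_codimensional nZ.2 ->
    finite_set F /\ linear_span (A nZ.1 nZ.2) = linear_span F.
  move=> -[n Z] /=.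
  have [cZ|H] := pselect (closed_finite_codimensional Z); last by exists set0.
  by have [F fF EF] := finA n Z cZ; exists F.
pose fix st n : set Y * set Y := if n is k.+1 then
    let G := (st k).2 `|` gen (k, (st k).1) in (next ((st k).1, G), G)
  else (next ([set: Y], [set e]), [set e]).
have stP n : closed_finite_codimensional (st n).1 /\ finite_set (st n).2.
  elim: n => [|n [cZ fG]] /=.
    split; last exact: finite_set1.
    have [] // := nextP ([set: Y], [set e]).
    - exact: closed_finite_codimensionalT.
    - exact: finite_set1.
  have fG' : finite_set ((st n).2 `|` gen (n, (st n).1)).
    by rewrite finite_setU; split => //; have [] := genP (n, (st n).1) cZ.
  by split => //; have [] // := nextP ((st n).1, (st n).2 `|` gen (n, (st n).1)).
exists (fun n => (st n).1), (fun n => (st n).2); split.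
- by move=> n; have [] := stP n.
- move=> n; split; last by move=> y Gy; left.
  have [_ fG] := stP n.+1; have [cZ _] := stP n.
  by have [] // := nextP ((st n).1, (st n.+1).2).
- move=> [|n].
    have [] // := nextP ([set: Y], [set e]).
    + exact: closed_finite_codimensionalT.
    + exact: finite_set1.
  have [_ fG] := stP n.+1; have [cZ _] := stP n.
  by have [] // := nextP ((st n).1, (st n.+1).2).
- move=> n y Ay; have [cZ _] := stP n.
  have : linear_span (A n (st n).1) y by exact: sub_linear_span.
  have [_ ->] := genP (n, (st n).1) cZ.
  by apply: linear_span_mono => z gz; right.
- exact: sub_linear_span.
Qed.

(** The separation of [W j] from [Z j] bounds the partial sums of length [j],
    since the remaining terms lie in [Z j]. *)
Lemma separated_partial_sum (R : realType) (Y : completeNormedModType R)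
    (Z W : nat -> set Y) (u : Y) (v : nat -> Y) (j N : nat) :
  (forall n, linear_subspace (Z n)) -> (forall n, linear_subspace (W n)) ->
  (forall n, Z n.+1 `<=` Z n) -> (forall n, W n `<=` W n.+1) ->
  (forall n a z, W n a -> Z n z -> `|a| <= 2 * `|a + z|) ->
  W 0 u -> (forall i, Z i (v i)) -> (forall i, W i.+1 (v i)) -> (j <= N)%N ->
  `|u + \sum_(0 <= i < j) v i| <= 2 * `|u + \sum_(0 <= i < N) v i|.
Proof.
move=> sZ sW Zdec Winc sep Wu Zv Wv jN.
have Wle m n : (m <= n)%N -> W m `<=` W n.
  by move=> /subnK <-; elim: (n - m)%N => // k IH y /IH; exact: Winc.
have Zle m n : (m <= n)%N -> Z n `<=` Z m.
  by move=> /subnK <-; elim: (n - m)%N => // k IH y /Zdec; exact: IH.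
rewrite (big_cat_nat (leq0n j) jN)/= addrA; apply: (sep j).
  apply: (linear_subspaceD (sW j)); first exact: (Wle 0%N).
  apply: (linear_subspace_sum (sW j)) => i; rewrite mem_index_iota => /andP[_ ij].
  exact: (Wle i.+1).
apply: (linear_subspace_sum (sZ j)) => i; rewrite mem_index_iota => /andP[ji _].
exact: (Zle _ i).
Qed.

(** * Tent functions *)

(** The tent of height [1] centred at [3/2 * 2 ^+ n], with support between
    [2 ^+ n / 2] and [5/2 * 2 ^+ n]; it is at least [1/2] between [2 ^+ n] and
    [2 ^+ n.+1]. *)
Definition tent (R : realType) (n : nat) (t : R) : R :=
  Num.max 0 (1 - `|t / 2 ^+ n - 3 / 2|).

Lemma tent_ge0 (R : realType) n (t : R) : 0 <= tent n t.
Proof. by rewrite /tent le_max lexx. Qed.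

Lemma tent_le1 (R : realType) n (t : R) : tent n t <= 1.
Proof. by rewrite /tent ge_max ler01/= gerBl. Qed.

Lemma tent_lipschitz (R : realType) n (t t' : R) :
  `|tent n t - tent n t'| <= `|t - t'| / 2 ^+ n.
Proof.
rewrite -[X in _ / X]gtr0_norm ?exprn_gt0// -normf_div mulrBl /tent.
move: (t / _) (t' / _) => a b.
have : `| `|a - 3 / 2| - `|b - 3 / 2| | <= `|a - b|.
  by apply: le_trans (ler_dist_dist _ _) _; rewrite opprB addrA subrK.
move: `|a - 3 / 2| `|b - 3 / 2| `|a - b| => x y d.
rewrite !ler_norml => /andP[H1 H2].
by case: (leP 0 (1 - x)) => ?; case: (leP 0 (1 - y)) => ?; lra.
Qed.

Lemma tent_support (R : realType) n (t : R) :
  tent n t != 0 -> 2 ^+ n < 2 * t /\ 2 * t < 5 * 2 ^+ n.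
Proof.
rewrite /tent; have [_|H _] := leP (1 - `|t / 2 ^+ n - 3 / 2|) 0.
  by rewrite eqxx.
have r0 : 0 < 2 ^+ n :> R by rewrite exprn_gt0.
have : `|t / 2 ^+ n - 3 / 2| < 1 by lra.
rewrite ltr_norml => /andP[H1 H2]; split.
  have : 2^-1 < t / 2 ^+ n by lra.
  by rewrite ltr_pdivlMr//; lra.
have : t / 2 ^+ n < 5 / 2 by lra.
by rewrite ltr_pdivrMr//; lra.
Qed.

(** At every [t >= 1] some tent is at least [1/2], and at most three tents, with
    consecutive indices, are nonzero. *)
Lemma tent_cover (R : realType) (t : R) : 1 <= t ->
  exists m, 2^-1 <= tent m t /\
    forall n, tent n t != 0 -> (m <= n.+1 <= m.+2)%N.
Proof.
move=> t1.
have ex : exists k, t < 2 ^+ k.+1.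
  exists (Num.bound t); apply: upper_nthrootP; exact: leqnSn.
have [m tm minm] := ex_minnP ex.
have mt : 2 ^+ m <= t.
  case: m minm {tm} => [|m] minm; first by rewrite expr0.
  by rewrite leNgt; apply/negP => /minm; rewrite ltnn.
exists m; split.
  have r0 : 0 < 2 ^+ m :> R by rewrite exprn_gt0.
  have H1 : 1 <= t / 2 ^+ m by rewrite ler_pdivlMr// mul1r.
  have H2 : t / 2 ^+ m < 2 by rewrite ltr_pdivrMr// -exprS.
  have : `|t / 2 ^+ m - 3 / 2| <= 2^-1 by rewrite ler_norml; lra.
  by rewrite /tent le_max => H; apply/orP; right; lra.
move=> n /tent_support[nt tn].
have lt2 i j : (2 : R) ^+ i < 2 ^+ j -> (i < j)%N by rewrite ltr_eXn2l// ltr1n.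
apply/andP; split.
  rewrite -ltnS; apply: lt2; rewrite !exprS.
  have : 0 < 2 ^+ n :> R by rewrite exprn_gt0.
  by lra.
have : (2 : R) ^+ n < 2 ^+ m.+2 by move: tm; rewrite !exprS; lra.
exact: lt2.
Qed.

(** * Gluing local embeddings *)

(** Translating and rescaling a local embedding. *)
Lemma local_embedding_normalize (R : realType) (X : metricType R)
    (Y : completeNormedModType R) (lambda : R) (B : set X) (Z : set Y)
    (f : X -> Y) (x0 : X) :
  linear_subspace Z -> B x0 -> local_embedding lambda B Z f ->
  exists F : X -> Y, [/\ F x0 = 0,
    forall x, B x -> Z (F x) /\ linear_span (f @` B) (F x) &
    bilipschitz_estimate 1 lambda B F].
Proof.
move=> sZ Bx0 [fZ [s s0 bf]].
exists (fun x => s^-1 *: (f x - f x0)); split.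
- by rewrite subrr scaler0.
- move=> x Bx; split.
    by apply: linear_subspaceZ => //; apply: linear_subspaceB => //; exact: fZ.
  have sS := linear_span_subspace (f @` B).
  apply: (linear_subspaceZ _ sS); apply: (linear_subspaceB sS).
    by apply: sub_linear_span; exists x.
  by apply: sub_linear_span; exists x0.
- move=> x y Bx By; rewrite -scalerBr opprB addrA subrK normrZ.
  rewrite gtr0_norm ?invr_gt0//.
  rewrite ler_pdivlMl// ler_pdivrMl// mul1r mulr1 mulrA [s * lambda]mulrC.
  exact: bf.
Qed.

(** One summand of the glued map: a normalised local embedding [F] of the ball
    of radius [3 * 2 ^+ n], weighted by the [n]-th tent at [1 + rho x].  The
    shift by [1] makes the tents of index [n >= 0] cover the whole space. *)
Section Piece.
Context (R : realType) (X : metricType R) (Y : completeNormedModType R).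
Context (lambda : R) (x0 : X) (n : nat) (F : X -> Y).
Hypothesis lambda_ge1 : 1 <= lambda.
Hypothesis F0 : F x0 = 0.
Let B := ball x0 (3 * 2 ^+ n).
Hypothesis bF : bilipschitz_estimate 1 lambda B F.

Let rho x := mdist x0 x.
Let w x := tent n (1 + rho x).

Let pow_gt0 : 0 < 2 ^+ n :> R. Proof. by rewrite exprn_gt0. Qed.

Let lambda_gt0 : 0 < lambda. Proof. exact: lt_le_trans lambda_ge1. Qed.

Let ball_rho x : B x <-> rho x < 3 * 2 ^+ n.
Proof. by rewrite /B ballEmdist. Qed.

Let B0 : B x0.
Proof. by apply/ball_rho; rewrite /rho mdistxx mulr_gt0. Qed.

Let w_support x : w x != 0 -> B x.
Proof. move=> /tent_support[_ H]; apply/ball_rho; have := pow_gt0; lra. Qed.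

Let rho_lip x y : `|rho x - rho y| <= mdist x y.
Proof.
have := metric_triangle x0 x y; have := metric_triangle x0 y x.
by rewrite (metric_sym y x) ler_norml /rho; lra.
Qed.

(* The ball has radius comparable to the width of the tent, so the growth of
   [F] compensates the slope of the weight. *)
Let weight_diff x y : B y ->
  `|(w x - w y) *: F y| <= 3 * lambda * `|rho x - rho y|.
Proof.
move=> By; rewrite normrZ.
have Fy : `|F y| <= lambda * (3 * 2 ^+ n).
  have /andP[_] := bF By B0; rewrite F0 subr0 mulr1 metric_sym => H.
  apply: le_trans H _; rewrite ler_pM2l//.
  exact/ltW/ball_rho.
have Hw : `|w x - w y| <= `|rho x - rho y| / 2 ^+ n.
  by apply: le_trans (tent_lipschitz _ _ _) _; rewrite opprD addrACA subrr add0r.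
apply: le_trans (ler_pM _ _ Hw Fy) _ => //.
have -> : `|rho x - rho y| / 2 ^+ n * (lambda * (3 * 2 ^+ n)) =
   3 * lambda * `|rho x - rho y| by field; rewrite expf_neq0.
exact: lexx.
Qed.

Let piece_split x y :
  w x *: F x - w y *: F y = w x *: (F x - F y) + (w x - w y) *: F y.
Proof. by rewrite scalerBr scalerBl addrA subrK. Qed.

Lemma piece_mem (S : set Y) x :
  linear_subspace S -> (forall z, B z -> S (F z)) -> S (w x *: F x).
Proof.
move=> sS SF; have [->|/w_support/SF] := eqVneq (w x) 0.
  by rewrite scale0r; have [] := (linear_subspaceP _).1 sS.
exact: linear_subspaceZ.
Qed.

(** The Lipschitz bound holds on all of [X], although [F] is controlled on the
    ball only: the weight vanishes outside the ball. *)
Lemma piece_lipschitz x y :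
  `|w x *: F x - w y *: F y| <= 4 * lambda * mdist x y.
Proof.
have d0 := mdist_ge0 x y.
have l0 := lambda_gt0.
have ld : 0 <= lambda * mdist x y by rewrite mulr_ge0// ltW.
have [By|nBy] := pselect (B y); last first.
  have wy : w y = 0 by apply/eqP; apply: contrapT => /negP /w_support.
  rewrite wy scale0r subr0.
  have [wx|wx] := eqVneq (w x) 0.
    by rewrite wx scale0r normr0; lra.
  have Bx := w_support wx.
  have := weight_diff y Bx; rewrite wy sub0r scaleNr normrN => H.
  have := rho_lip y x; rewrite metric_sym -(ler_pM2l l0) => H2; lra.
rewrite piece_split; apply: le_trans (ler_normD _ _) _.
have H := weight_diff x By.
have := rho_lip x y; rewrite -(ler_pM2l l0) => H2.
suff : `|w x *: (F x - F y)| <= lambda * mdist x y by lra.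
have [wx|wx] := eqVneq (w x) 0; first by rewrite wx scale0r normr0.
have /andP[_ H3] := bF (w_support wx) By.
rewrite normrZ ger0_norm ?tent_ge0//; rewrite mulr1 in H3.
by apply: le_trans H3; rewrite ler_piMl ?tent_le1.
Qed.

Lemma piece_lower_bound x y : 2^-1 <= w x -> rho y <= rho x ->
  mdist x y / 2 - 3 * lambda * `|rho x - rho y| <= `|w x *: F x - w y *: F y|.
Proof.
move=> wx yx.
have Bx : B x by apply: w_support; rewrite gt_eqF//; lra.
have By : B y by apply/ball_rho; apply: le_lt_trans yx _; exact/ball_rho.
have H := weight_diff x By.
have /andP[H3 _] := bF Bx By; rewrite mul1r in H3.
have H4 : mdist x y / 2 <= `|w x *: (F x - F y)|.
  rewrite normrZ ger0_norm ?tent_ge0// mulrC ler_pM// ?mdist_ge0//.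
have := ler_normB (w x *: F x - w y *: F y) ((w x - w y) *: F y).
by rewrite piece_split addrK; lra.
Qed.

End Piece.

Lemma sum_window_le3 (R : realType) (m N : nat) :
  \sum_(0 <= i < N) (m <= i.+1 <= m.+2)%N%:R <= 3 :> R.
Proof.
rewrite -natr_sum (ler_nat R _ 3).
have -> : (\sum_(0 <= i < N) (m <= i.+1 <= m.+2) =
  count (fun i => m <= i.+1 <= m.+2) (index_iota 0 N))%N.
  by rewrite -sum1_count [RHS]big_mkcond; apply: eq_bigr => i _; case: ifP.
rewrite -size_filter; apply: (@uniq_leq_size _ _ [:: m.-1; m; m.+1]).
  by rewrite filter_uniq// iota_uniq.
move=> i; rewrite mem_filter !inE => /andP[/andP[mi im] _].
case: m mi im => [|m] /= mi im; lia.
Qed.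

Lemma bilipschitz_subsingleton (R : realType) (X : metricType R)
    (Y : completeNormedModType R) :
  (forall x y : X, x = y) -> exists g : X -> Y, bilipschitz_embedding g.
Proof.
move=> X1; exists (fun=> 0), 1, 1; split => // x y _ _.
by rewrite (X1 x y) mdistxx subrr normr0 !mulr0 lexx.
Qed.

(** The gluing construction, given normalised local embeddings [F n] of the
    balls about [x0] into separated pieces of [Y]; [W n] plays the role of the
    span of [e] and of the ranges of [F i] for [i < n]. *)
Lemma bilipschitz_of_separated (R : realType) (X : metricType R)
    (Y : completeNormedModType R) (lambda : R) (x0 : X) (e : Y)
    (Z W : nat -> set Y) (F : nat -> X -> Y) :
  1 <= lambda -> `|e| = 1 -> W 0 e ->
  (forall n, linear_subspace (Z n)) -> (forall n, linear_subspace (W n)) ->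
  (forall n, Z n.+1 `<=` Z n) -> (forall n, W n `<=` W n.+1) ->
  (forall n a z, W n a -> Z n z -> `|a| <= 2 * `|a + z|) ->
  (forall n, F n x0 = 0) ->
  (forall n x, ball x0 (3 * 2 ^+ n) x -> Z n (F n x) /\ W n.+1 (F n x)) ->
  (forall n, bilipschitz_estimate 1 lambda (ball x0 (3 * 2 ^+ n)) (F n)) ->
  exists g : X -> Y, bilipschitz_embedding g.
Proof.
move=> lam1 e1 We sZ sW Zdec Winc sep F0 FZW bF.
pose rho x := mdist x0 x.
pose h n x := tent n (1 + rho x) *: F n x.
have hZ n x : Z n (h n x) by apply: (piece_mem _ (sZ n)) => z /FZW[].
have hW n x : W n.+1 (h n x) by apply: (piece_mem _ (sW n.+1)) => z /FZW[].
have /choice[m mP] : forall x, exists m, 2^-1 <= tent m (1 + rho x) /\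
    forall n, tent n (1 + rho x) != 0 -> (m <= n.+1 <= m.+2)%N.
  by move=> x; apply: tent_cover; rewrite lerDl mdist_ge0.
have h0 n x : ~~ (m x <= n.+1 <= (m x).+2)%N -> h n x = 0.
  move=> H; rewrite /h; have [->|/(mP x).2] := eqVneq (tent n (1 + rho x)) 0.
    by rewrite scale0r.
  by rewrite (negPf H).
(* The sum runs over all indices that contribute at [x], so that enlarging its
   range does not change it. *)
pose g x := rho x *: e + \sum_(0 <= i < (m x).+2) h i x.
have gE N x : ((m x).+2 <= N)%N -> g x = rho x *: e + \sum_(0 <= i < N) h i x.
  move=> mN; rewrite /g [in RHS](big_cat_nat (leq0n _) mN)/=.
  rewrite [X in _ + (_ + X)](_ : _ = 0) ?addr0// big_nat_cond big1// => i.
  rewrite andbT => /andP[mi _]; apply: h0.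
  by rewrite negb_and -!ltnNge; apply/orP; right.
have rho_lip x y : `|rho x - rho y| <= mdist x y.
  have := metric_triangle x0 x y; have := metric_triangle x0 y x.
  by rewrite (metric_sym y x) ler_norml /rho; lra.
pose N x y := maxn (m x).+2 (m y).+2.
have gB x y : g x - g y =
    (rho x - rho y) *: e + \sum_(0 <= i < N x y) (h i x - h i y).
  rewrite (gE (N x y) x) ?leq_maxl// (gE (N x y) y) ?leq_maxr//.
  by rewrite sumrB scalerBl opprD addrACA.
have upper x y : `|g x - g y| <= 25 * lambda * mdist x y.
  have d0 := mdist_ge0 x y.
  have ld : mdist x y <= lambda * mdist x y by rewrite ler_peMl.
  rewrite gB; apply: le_trans (ler_normD _ _) _.
  rewrite normrZ e1 mulr1.
  suff : `|\sum_(0 <= i < N x y) (h i x - h i y)| <= 24 * (lambda * mdist x y).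
    by have := rho_lip x y; lra.
  pose c x i : R := (m x <= i.+1 <= (m x).+2)%N%:R.
  have c0 z i : 0 <= c z i by rewrite /c ler0n.
  have hc i : `|h i x - h i y| <= (c x i + c y i) * (4 * lambda * mdist x y).
    have := piece_lipschitz lam1 (F0 i) (bF i) x y; rewrite -/(h i x) -/(h i y).
    have [xi|/negbTE xi] := boolP (m x <= i.+1 <= (m x).+2)%N.
      move=> /le_trans; apply; rewrite ler_peMl//; first by lra.
      by rewrite {1}/c xi lerDl.
    have [yi|/negbTE yi] := boolP (m y <= i.+1 <= (m y).+2)%N.
      move=> /le_trans; apply; rewrite ler_peMl//; first by lra.
      by rewrite {2}/c yi lerDr.
    by rewrite !h0 ?xi ?yi// subrr normr0 /c xi yi addr0 mul0r.
  apply: le_trans (ler_norm_sum _ _ _) _.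
  apply: le_trans (ler_sum _ (fun i _ => hc i)) _.
  rewrite -mulr_suml big_split/=.
  have cx := sum_window_le3 R (m x) (N x y).
  have cy := sum_window_le3 R (m y) (N x y).
  have -> : 24 * (lambda * mdist x y) = (3 + 3) * (4 * lambda * mdist x y) by lra.
  by rewrite ler_wpM2r//; [lra|rewrite lerD].
have lower x y : rho y <= rho x ->
    mdist x y <= (8 + 12 * lambda) * `|g x - g y|.
  move=> yx; pose v i := h i x - h i y.
  have Wu : W 0%N ((rho x - rho y) *: e) by exact: linear_subspaceZ.
  have Zv i : Z i (v i) by exact: linear_subspaceB.
  have Wv i : W i.+1 (v i) by exact: linear_subspaceB.
  have part j : (j <= N x y)%N ->
      `|(rho x - rho y) *: e + \sum_(0 <= i < j) v i| <= 2 * `|g x - g y|.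
    by rewrite gB; exact: (separated_partial_sum sZ sW Zdec Winc sep).
  have H1 := part 0%N (leq0n _).
  rewrite big_geq// addr0 normrZ e1 mulr1 in H1.
  have mN : (m x < N x y)%N by rewrite leq_max ltnS leqnSn.
  have H2 := part (m x) (ltnW mN); have H3 := part _ mN.
  have H4 : `|v (m x)| <= 4 * `|g x - g y|.
    have -> : v (m x) = ((rho x - rho y) *: e + \sum_(0 <= i < (m x).+1) v i) -
                        ((rho x - rho y) *: e + \sum_(0 <= i < m x) v i).
      by rewrite big_nat_recr//= addrA [RHS]addrC addKr.
    by apply: le_trans (ler_normB _ _) _; lra.
  have H5 := piece_lower_bound lam1 (F0 (m x)) (bF (m x)) (mP x).1 yx.
  rewrite -/(h _ x) -/(h _ y) -/(v _) -!/(rho _) in H5.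
  have : lambda * `|rho x - rho y| <= lambda * (2 * `|g x - g y|).
    by rewrite ler_pM2l//; lra.
  lra.
have C0 : 0 < 8 + 12 * lambda by lra.
exists g, (8 + 12 * lambda)^-1, (25 * lambda * (8 + 12 * lambda)).
split; first by rewrite invr_gt0.
  have : 25 * lambda * 8 <= 25 * lambda * (8 + 12 * lambda).
    by rewrite ler_wpM2l//; lra.
  lra.
move=> x y _ _; rewrite mulfK ?gt_eqF// upper andbT ler_pdivrMl//.
have [yx|/ltW xy] := leP (rho y) (rho x); first exact: lower.
by rewrite metric_sym distrC; exact: lower.
Qed.

Unset Implicit Arguments.

Theorem theorem3 (R : realType) (X : metricType R)
    (Y : completeNormedModType R) (lambda : R)
    (f : set X -> set Y -> X -> Y)
    (lambda_ge1 : 1 <= lambda)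
    (f_local : forall (Z : set Y) (B : set X),
       closed_finite_codimensional Z -> metric_ball B ->
       local_embedding lambda B Z (f B Z))
    (f_findim : forall (B : set X) (Z : set Y),
       metric_ball B -> closed_finite_codimensional Z ->
       finite_dimensional (linear_span (f B Z @` B))) :
  exists g : X -> Y, bilipschitz_embedding g.
Proof.
have [[x0 _]|X0] := pselect (exists x : X, True); last first.
  by apply: bilipschitz_subsingleton => x; exfalso; apply: X0; exists x.
(* If [Y] is trivial, the lower bound of a local embedding forces [X] to be a
   point. *)
have [[y0 y0N0]|Y0] := pselect (exists y : Y, y != 0); last first.
  apply: bilipschitz_subsingleton => x y; apply: mdist_positivity.
  have Yall (z z' : Y) : z = z'.
    have Yz (z1 : Y) : z1 = 0.
      by apply/eqP; apply: contrapT => /negP H; apply: Y0; exists z1.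
    by rewrite (Yz z) (Yz z').
  have r0 : 0 < mdist x y + 1 by rewrite ltr_wpDl// mdist_ge0.
  have mB : metric_ball (ball x (mdist x y + 1)) by exists x, (mdist x y + 1).
  have [_ [s s0]] := f_local _ _ (closed_finite_codimensionalT Y) mB.
  move=> /(_ x y); rewrite !ballEmdist/= mdistxx ltrDl.
  move=> /(_ r0 ltr01) /andP[+ _].
  rewrite (Yall (_ - _) 0) normr0 pmulr_rle0// => d0.
  by apply/le_anti; rewrite d0 mdist_ge0.
pose e := `|y0|^-1 *: y0.
have e1 : `|e| = 1.
  by rewrite normrZ gtr0_norm ?invr_gt0 ?normr_gt0// mulVf ?normr_eq0.
pose B n := ball x0 (3 * 2 ^+ n : R).
have r0 n : 0 < 3 * 2 ^+ n :> R by rewrite mulr_gt0// exprn_gt0.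
have mB n : metric_ball (B n) by exists x0, (3 * 2 ^+ n).
have [n Z cZ|Z [G [cZ incl sep AG Ge]]] :=
    @separated_sequence R Y e (fun n Z => f (B n) Z @` B n).
  exact: f_findim.
have sZ n : linear_subspace (Z n) by have [_ []] := cZ n.
have /choice[F FP] : forall n, exists F : X -> Y, [/\ F x0 = 0,
    forall x, B n x -> Z n (F x) /\ linear_span (f (B n) (Z n) @` B n) (F x) &
    bilipschitz_estimate 1 lambda (B n) F].
  move=> n; apply: local_embedding_normalize => //; last exact: f_local.
  by rewrite /B ballEmdist/= mdistxx.
apply: (@bilipschitz_of_separated R X Y lambda x0 e Z
  (fun n => linear_span (G n)) F) => //.
- by move=> n; exact: linear_span_subspace.
- by move=> n; have [] := incl n.
- by move=> n; apply: linear_span_mono; have [] := incl n.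
- by move=> n; have [] := FP n.
- move=> n x Bx; have [_ /(_ x Bx)[ZF sF] _] := FP n; split => //.
  by move: sF; apply: linear_span_sub; [exact: linear_span_subspace|exact: AG].
- by move=> n; have [] := FP n.
Qed.
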